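(* Let $\Gamma$ be a $\delta$-hyperbolic graph. Suppose $\mathcal{L}$ is a set of geodesics in $\Gamma$ such that any two vertices of $\Gamma$ are joined by a geodesic in $\mathcal{L}$. If $\mathcal{L}$ satisfies property B with constants $\ell$, $k=2\delta$ and $D$, then $\operatorname{asdim}\Gamma\le 2D-1$.
   Context: A graph $\Gamma$ is regarded as a connected geodesic metric space with all edges of length 1; $V(\Gamma)$ is its vertex set. A geodesic metric space is $\delta$-hyperbolic ($\delta\ge 0$) if in every geodesic triangle each side is contained in the $\delta$-neighborhood of the union of the other two sides. $N(x;r)$ denotes the (closed) ball of radius $r$ centered at $x$. Asymptotic dimension: for a metric space $X$ and integer $n\ge 0$, $\operatorname{asdim}X\le n$ if for every $r\in\mathbb{N}$ there is a cover $\{U_i\}_i$ of $X$ by subsets of uniformly bounded diameter such that $\#\{i\mid N(x;r)\cap U_i\ne\emptyset\}\le n+1$ for all $x\in X$. Property B: let $\mathcal{L}$ be a set of geodesics in $\Gamma$ such that any two vertices are connected by a member of $\mathcal{L}$. For $a,b\in V(\Gamma)$ let $\mathcal{L}(a,b)$ be the set of all geodesics in $\mathcal{L}$ connecting $a$ and $b$, and $G(a,b)=\bigcup\mathcal{L}(a,b)\subset\Gamma$. For $A,B\subset V(\Gamma)$ let $\mathcal{L}(A,B)=\bigcup\{\mathcal{L}(a,b)\mid a\in A,\,b\in B\}$ and $G(A,B)=\bigcup\mathcal{L}(A,B)$. Write $G(a,b;r)=G(N(a;r)\cap V(\Gamma),\,N(b;r)\cap V(\Gamma))$. The set $\mathcal{L}$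 satisfies property B with constants $\ell\ge 0$, $k\ge 0$ and $D\in\{1,2,3,\dots\}$ if for all $a,b\in V(\Gamma)$, $r\in\mathbb{N}$ and every vertex $c\in G(a,b)$ with $d(c,\{a,b\})\ge r+\ell$: the set of vertices in $G(a,b;r)\cap N(c;k)$ has at most $D$ elements, and any geodesic connecting $N(a;r)$ to $N(b;r)$ intersects $N(c;k)$. *)

(* Defs.v *)
From HB Require Import structures.
From mathcomp Require Import all_boot all_order all_algebra.
From mathcomp Require Import all_classical all_reals all_analysis.
From mathcomp Require Import lra.

Set Implicit Arguments.
Unset Strict Implicit.
Unset Printing Implicit Defensive.

Import Order.TTheory GRing.Theory Num.Theory.

Local Open Scope classical_set_scope.
Local Open Scope ring_scope.

Section MetricSpaces.
Variables (R : realType) (X : metricType R).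

(* [closed_ball] of the library is the closure of an open ball; here the ball
   is defined by a non-strict inequality, so that [cball x 0] is [set x]. *)
Definition cball (x : X) (r : R) : set X := [set y | mdist x y <= r].

(* A geodesic is identified with its image, so that a geodesic joining x to y
   also joins y to x, and unions of geodesics are subsets of X. *)
Definition geodesic (x y : X) (S : set X) : Prop :=
  exists g : R -> X,
    [/\ g 0 = x, g (mdist x y) = y,
        forall s t, 0 <= s <= mdist x y -> 0 <= t <= mdist x y ->
          mdist (g s) (g t) = `|s - t|
      & S = g @` [set t | 0 <= t <= mdist x y]].

Definition geodesic_space : Prop := forall x y : X, exists S, geodesic x y S.

(* The neighborhood is closed, so that 0-hyperbolicity makes sense. *)
Definition nbhd (d : R) (A : set X) : set X :=
  [set x | exists2 y, A y & mdist x y <= d].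

Definition hyperbolic (delta : R) : Prop :=
  [/\ 0 <= delta, geodesic_space
    & forall (x y z : X) (A B C : set X),
        geodesic x y A -> geodesic y z B -> geodesic z x C ->
        [/\ A `<=` nbhd delta (B `|` C), B `<=` nbhd delta (C `|` A)
          & C `<=` nbhd delta (A `|` B)]].

Definition asdim_le (n : nat) : Prop :=
  forall r : nat, exists (I : Type) (U : I -> set X),
    [/\ \bigcup_i U i = [set: X],
        exists M : R, forall i x y, U i x -> U i y -> mdist x y <= M
      & forall x, ([set i | cball x r%:R `&` U i !=set0] #<= `I_n.+1)%card].

End MetricSpaces.

Fixpoint walk (V E : Type) (src tgt : E -> V) (n : nat) (u v : V) : Prop :=
  if n is m.+1 then
    exists e, (src e = u /\ walk src tgt m (tgt e) v)
           \/ (tgt e = u /\ walk src tgt m (src e) v)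
  else u = v.

(* Loops and multiple edges are allowed, and no finiteness is assumed; the
   orientation of the edges only serves to parametrize them by [0, 1]. *)
Record graph := Graph {
  vert : Type;
  edge : Type;
  src : edge -> vert;
  tgt : edge -> vert;
  graph_connected : forall u v, exists n, walk src tgt n u v }.

Section VertexDistance.
Variable G : graph.
Implicit Types u v w : vert G.

Lemma walk_exists u v : exists n, `[< walk (@src G) (@tgt G) n u v >].
Proof.
by have [n nP] := graph_connected u v; exists n; apply/asboolP.
Qed.

Definition vdist u v : nat := ex_minn (walk_exists u v).

Lemma vdist_walk u v : walk (@src G) (@tgt G) (vdist u v) u v.
Proof. by rewrite /vdist; case: ex_minnP => n /asboolP. Qed.

Lemma vdist_le n u v : walk (@src G) (@tgt G) n u v -> (vdist u v <= n)%N.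
Proof.
by move=> uv; rewrite /vdist; case: ex_minnP => m _; apply; apply/asboolP.
Qed.

Lemma walk_cat m n u v w : walk (@src G) (@tgt G) m u v ->
  walk (@src G) (@tgt G) n v w -> walk (@src G) (@tgt G) (m + n) u w.
Proof.
elim: m u => [u -> //|m IH u /= [e [[eu ev]|[eu ev]]] vw]; exists e.
  by left; split=> //; apply: IH.
by right; split=> //; apply: IH.
Qed.

Lemma walk_sym n u v : walk (@src G) (@tgt G) n u v ->
  walk (@src G) (@tgt G) n v u.
Proof.
elim: n u => [u -> //|n IH u [e uev]]; rewrite -addn1.
by case: uev => [[eu /IH ev]|[eu /IH ev]]; apply: (walk_cat ev); exists e;
  [right|left].
Qed.

Lemma vdistxx u : vdist u u = 0%N.
Proof. by apply/eqP; rewrite -leqn0; apply: vdist_le. Qed.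

Lemma vdist_eq0 u v : vdist u v = 0%N -> u = v.
Proof. by move=> uv; have := vdist_walk u v; rewrite uv. Qed.

Lemma vdistC u v : vdist u v = vdist v u.
Proof.
by apply/eqP; rewrite eqn_leq !vdist_le//; apply/walk_sym/vdist_walk.
Qed.

Lemma vdist_triangle u v w : (vdist u w <= vdist u v + vdist v w)%N.
Proof. by apply: vdist_le; apply: walk_cat; apply: vdist_walk. Qed.

Lemma vdist_edge (e : edge G) : (vdist (src e) (tgt e) <= 1)%N.
Proof. by apply: vdist_le; exists e; left. Qed.

End VertexDistance.

(* The geometric realization of a graph, as the disjoint union of the vertices
   and of the open edges; [Inner e t] lies at distance t from [src e] and 1 - t
   from [tgt e] along e. *)
Inductive realization (R : realType) (G : graph) : Type :=
| Vertex of vert G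
| Inner (e : edge G) (t : R) of 0 < t < 1.

Arguments Vertex {R G} _.
Arguments Inner {R G} e t _.

HB.instance Definition _ (R : realType) (G : graph) :=
  gen_eqMixin (realization R G).
HB.instance Definition _ (R : realType) (G : graph) :=
  gen_choiceMixin (realization R G).

Section PathMetric.
Variables (R : realType) (G : graph).
Local Notation point := (realization R G).
Implicit Types (p q r : point) (b c : bool).

(* The two ways of reaching a vertex from p without crossing another vertex
   (they coincide if p is a vertex), and their lengths. *)
Definition exit p b : vert G :=
  match p with
  | Vertex v => v
  | Inner e _ _ => if b then tgt e else src e
  end.

Definition exit_cost p b : R :=
  match p with
  | Vertex _ => 0
  | Inner _ t _ => if b then 1 - t else t
  end.

Definition route p q b c : R :=
  exit_cost p b + (vdist (exit p b) (exit q c))%:R + exit_cost q c.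

Definition via p q : R :=
  Num.min (Num.min (route p q false false) (route p q false true))
          (Num.min (route p q true false) (route p q true true)).

(* The length of a shortest path from p to q in the graph with edges of length
   1: such a path passes through a vertex or stays in one open edge. *)
Definition gdist p q : R :=
  match p, q with
  | Inner e s _, Inner f t _ =>
      if `[< e = f >] then Num.min `|s - t| (via p q) else via p q
  | _, _ => via p q
  end.

Lemma via_route p q : exists b c, via p q = route p q b c.
Proof.
rewrite /via !minElt; case: ifP => _; case: ifP => _;
by do 2 eexists.
Qed.

Lemma via_le p q b c : via p q <= route p q b c.
Proof.
by rewrite /via !ge_min; case: b; case: c; rewrite lexx ?orbT.
Qed.

Lemma gdist_le_route p q b c : gdist p q <= route p q b c.
Proof.
have := via_le p q b c; rewrite /gdist.
case: p => [v|e s hs]; case: q => [w|f t ht] //.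
by case: ifP => // _ le_via; rewrite ge_min le_via orbT.
Qed.

Lemma gdist_le_inner e s t hs ht :
  gdist (Inner e s hs) (Inner e t ht) <= `|s - t|.
Proof. by rewrite /gdist asboolT// ge_min lexx. Qed.

Lemma gdist_cases p q :
  (exists b c, gdist p q = route p q b c) \/
  (exists e s t hs ht, [/\ p = Inner e s hs, q = Inner e t ht
     & gdist p q = `|s - t|]).
Proof.
have V := via_route p q; rewrite /gdist.
case: p V => [v|e s hs]; case: q => [w|f t ht] V; try by left.
case: ifP => [/asboolP ef|_]; last by left.
rewrite minElt; case: ifP => _; last by left.
by right; subst f; exists e, s, t, hs, ht; split.
Qed.

Lemma exit_cost_ge0 p b : 0 <= exit_cost p b.
Proof. by case: p => [v|e t ht] //=; case: b; lra. Qed.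

Lemma route_sym p q b c : route p q b c = route q p c b.
Proof. by rewrite /route vdistC; lra. Qed.

Lemma exit_dist p b c :
  (vdist (exit p b) (exit p c))%:R <= exit_cost p b + exit_cost p c.
Proof.
case: p => [v|e t ht] /=; first by rewrite vdistxx addr0.
have le1 : (vdist (src e) (tgt e))%:R <= 1 :> R.
  by rewrite -[1]/(1%:R) ler_nat vdist_edge.
case: b; case: c; rewrite ?vdistxx; [lra| |lra|lra].
by rewrite vdistC; lra.
Qed.

Lemma gdistxx p : gdist p p = 0.
Proof.
apply/eqP; rewrite eq_le; apply/andP; split; last first.
  have [[b [c ->]]|[e [s [t [hs [ht [_ _ ->]]]]]]] := gdist_cases p p => //.
  by rewrite /route !addr_ge0 ?exit_cost_ge0.
case: p => [v|e t ht].
  apply: le_trans (gdist_le_route _ _ true true) _.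
  by rewrite /route /= vdistxx !addr0.
by apply: le_trans (gdist_le_inner _ _ _) _; rewrite subrr normr0.
Qed.

Lemma gdist_positivity p q : gdist p q = 0 -> p = q.
Proof.
have [[b [c ->]]|[e [s [t [hs [ht [-> -> ->]]]]]]] := gdist_cases p q.
  move/eqP; rewrite /route paddr_eq0 ?addr_ge0 ?exit_cost_ge0//.
  rewrite paddr_eq0 ?exit_cost_ge0// pnatr_eq0 -andbA => /and3P[].
  case: p => [v|e s hs] /=; last first.
    by case: b => /eqP ? _ _; exfalso; lra.
  case: q => [w|f t ht] /=; last first.
    by case: c => _ _ /eqP ?; exfalso; lra.
  by move=> _ /eqP/vdist_eq0 ->.
move=> /eqP; rewrite normr_eq0 subr_eq0 => /eqP st; subst t.
by congr Inner; apply: bool_irrelevance.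
Qed.

Lemma gdist_sym p q : gdist p q = gdist q p.
Proof.
suff le_sym p' q' : gdist p' q' <= gdist q' p'.
  by apply/eqP; rewrite eq_le !le_sym.
have [[b [c ->]]|[e [s [t [hs [ht [-> -> ->]]]]]]] := gdist_cases q' p'.
  by rewrite route_sym gdist_le_route.
by rewrite distrC gdist_le_inner.
Qed.

Lemma exit_cost_inner e s t hs ht b :
  exit_cost (Inner e s hs) b <= exit_cost (Inner e t ht) b + `|s - t|.
Proof.
have := ler_norm (s - t); have := ler_norm (t - s); rewrite (distrC t s).
by rewrite /exit_cost; case: b; lra.
Qed.

Lemma gdist_triangle q p r : gdist p r <= gdist p q + gdist q r.
Proof.
have [[b [c ->]]|[e [s [t [hs [ht [Ep Eq ->]]]]]]] := gdist_cases p q;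
have [[b' [c' ->]]|[e' [s' [t' [hs' [ht' [Eq' Er ->]]]]]]] := gdist_cases q r.
- apply: le_trans (gdist_le_route p r b c') _; rewrite /route.
  have le3 : (vdist (exit p b) (exit r c'))%:R <=
      (vdist (exit p b) (exit q c))%:R + (vdist (exit q c) (exit q b'))%:R
      + (vdist (exit q b') (exit r c'))%:R :> R.
    rewrite -!natrD ler_nat.
    apply: leq_trans (vdist_triangle _ (exit q b') _) _.
    by rewrite leq_add2r vdist_triangle.
  by have := exit_dist q c b'; lra.
- subst q r; apply: le_trans (gdist_le_route _ _ b c) _; rewrite /route.
  have := exit_cost_inner e' ht' hs' c; rewrite (distrC t').
  by rewrite -[exit _ c]/(exit (Inner e' s' hs') c); lra.
- subst p q; apply: le_trans (gdist_le_route _ _ b' c') _; rewrite /route.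
  have := exit_cost_inner e hs ht b'.
  by rewrite -[exit (Inner e s hs) _]/(exit (Inner e t ht) b'); lra.
- subst p q r; case: Eq' => ee' ts'; subst e' s'.
  by apply: le_trans (gdist_le_inner _ _ _) _; apply: ler_distD.
Qed.

HB.instance Definition _ := isMetric.Build R (realization R G)
  gdistxx gdist_positivity gdist_sym gdist_triangle.

Lemma mdist_gdist p q : mdist p q = gdist p q.
Proof. by []. Qed.

Definition lip_path p q (l : R) : Prop :=
  exists g : R -> point, [/\ 0 <= l, g 0 = p, g l = q
    & forall s t, 0 <= s -> s <= t -> t <= l -> gdist (g s) (g t) <= t - s].

Lemma lip_path_cat p q r l m :
  lip_path p q l -> lip_path q r m -> lip_path p r (l + m).
Proof.
move=> [g [l0 g0 gl glip]] [h [m0 h0 hm hlip]].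
exists (fun t => if t <= l then g t else h (t - l)); split.
- by rewrite addr_ge0.
- by rewrite l0.
- case: ifP => lm; last by rewrite addrAC subrr add0r.
  have m00 : m = 0 by lra.
  by rewrite m00 addr0 gl -h0 -hm m00.
- move=> s t s0 st tlm.
  have [sl|sl] := leP s l; have [tl|tl] := leP t l.
  + exact: glip.
  + apply: le_trans (gdist_triangle q _ _) _.
    have -> : t - s = (l - s) + (t - l - 0) by lra.
    by apply: lerD; [rewrite -gl; apply: glip|rewrite -h0; apply: hlip]; lra.
  + lra.
  + have -> : t - s = (t - l) - (s - l) by lra.
    by apply: hlip; lra.
Qed.

Lemma lip_path_sym p q l : lip_path p q l -> lip_path q p l.
Proof.
move=> [g [l0 g0 gl glip]]; exists (fun t => g (l - t)); split => //.
- by rewrite subr0.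
- by rewrite subrr.
- move=> s t s0 st tl; rewrite gdist_sym.
  have -> : t - s = (l - s) - (l - t) by lra.
  by apply: glip; lra.
Qed.

(* The edge e parametrized by [0, 1]. *)
Definition edge_point (e : edge G) (t : R) : point :=
  match pselect (0 < t < 1) with
  | left h => Inner e t h
  | right _ => if t <= 0 then Vertex (src e) else Vertex (tgt e)
  end.

Lemma edge_point_inner e t (h : 0 < t < 1) : edge_point e t = Inner e t h.
Proof.
rewrite /edge_point; case: pselect => // h'.
by congr Inner; apply: bool_irrelevance.
Qed.

Lemma edge_point0 e : edge_point e 0 = Vertex (src e).
Proof.
by rewrite /edge_point; case: pselect => [h|_]; [exfalso; lra|rewrite lexx].
Qed.

Lemma edge_point1 e : edge_point e 1 = Vertex (tgt e).
Proof.
rewrite /edge_point; case: pselect => [h|_]; first by exfalso; lra.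
by rewrite ler10.
Qed.

Lemma edge_point_lip e s t : 0 <= s -> s <= t -> t <= 1 ->
  gdist (edge_point e s) (edge_point e t) <= t - s.
Proof.
move=> s0 st t1.
have [->|s_neq0] := eqVneq s 0; have [->|t_neq1] := eqVneq t 1.
- rewrite edge_point0 edge_point1.
  apply: le_trans (gdist_le_route _ _ true true) _.
  rewrite /route /= add0r addr0 subr0 -[leRHS]/(1%:R) ler_nat.
  exact: vdist_edge.
- have [->|t_neq0] := eqVneq t 0; first by rewrite gdistxx subrr.
  have ht : 0 < t < 1 by lra.
  rewrite edge_point0 (edge_point_inner _ ht).
  apply: le_trans (gdist_le_route _ _ true false) _.
  by rewrite /route /= vdistxx; lra.
- have [->|s_neq1] := eqVneq s 1; first by rewrite gdistxx subrr.
  have hs : 0 < s < 1 by lra.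
  rewrite edge_point1 (edge_point_inner _ hs).
  apply: le_trans (gdist_le_route _ _ true false) _.
  by rewrite /route /= vdistxx; lra.
- have hs : 0 < s < 1 by lra.
  have ht : 0 < t < 1 by lra.
  rewrite (edge_point_inner _ hs) (edge_point_inner _ ht).
  by apply: le_trans (gdist_le_inner _ _ _) _; rewrite distrC ger0_norm; lra.
Qed.

Lemma lip_path_edge e s t : 0 <= s -> s <= t -> t <= 1 ->
  lip_path (edge_point e s) (edge_point e t) (t - s).
Proof.
move=> s0 st t1; exists (fun x => edge_point e (s + x)); split.
- lra.
- by rewrite addr0.
- by congr edge_point; lra.
- move=> x y x0 xy yts; have -> : y - x = (s + y) - (s + x) by lra.
  by apply: edge_point_lip; lra.
Qed.

Lemma lip_path_walk n u v : walk (@src G) (@tgt G) n u v ->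
  lip_path (Vertex u) (Vertex v) n%:R.
Proof.
have path1 e : lip_path (Vertex (src e)) (Vertex (tgt e)) 1.
  rewrite -edge_point0 -edge_point1 -[X in lip_path _ _ X](subr0 1).
  by apply: lip_path_edge; lra.
elim: n u => [u ->|n IH u [e [[<- /IH ev]|[<- /IH ev]]]].
- by exists (fun=> Vertex v); split=> // s t _ st _; rewrite gdistxx subr_ge0.
- by rewrite -natr1 addrC; apply: lip_path_cat (path1 e) ev.
- rewrite -natr1 addrC; apply: lip_path_cat ev.
  exact: lip_path_sym (path1 e).
Qed.

Lemma lip_path_exit p b : lip_path p (Vertex (exit p b)) (exit_cost p b).
Proof.
case: p => [v|e t ht] /=; first exact: (@lip_path_walk 0 v v).
have [t0 t1] := andP ht; rewrite -edge_point_inner; case: b.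
  by rewrite -edge_point1; apply: lip_path_edge; lra.
rewrite -edge_point0 -[X in lip_path _ _ X](subr0 t).
by apply/lip_path_sym/lip_path_edge; lra.
Qed.

Lemma lip_path_gdist p q : lip_path p q (gdist p q).
Proof.
have [[b [c ->]]|[e [s [t [hs [ht [-> -> ->]]]]]]] := gdist_cases p q.
  apply: lip_path_cat (lip_path_sym (lip_path_exit q c)).
  apply: lip_path_cat (lip_path_exit p b) _.
  exact/lip_path_walk/vdist_walk.
have [s0 s1] := andP hs; have [t0 t1] := andP ht.
rewrite -!edge_point_inner; have [st|/ltW ts] := leP s t.
  by rewrite distrC ger0_norm ?subr_ge0//; apply: lip_path_edge; lra.
rewrite ger0_norm ?subr_ge0//.
by apply/lip_path_sym/lip_path_edge; lra.
Qed.

Theorem realization_geodesic : geodesic_space (realization R G).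
Proof.
move=> p q; have [g [l0 g0 gl glip]] := lip_path_gdist p q.
exists (g @` [set t | 0 <= t <= mdist p q]), g; split=> // s t.
rewrite mdist_gdist.
wlog st : s t / s <= t.
  move=> W hs ht; have [st|/ltW ts] := leP s t; first exact: W.
  by rewrite metric_sym distrC; apply: W.
move=> /andP[s0 sl] /andP[t0 tl]; rewrite distrC ger0_norm ?subr_ge0//.
apply/eqP; rewrite eq_le; apply/andP; split; first exact: glip.
have s_le := glip 0 s (lexx _) s0 sl.
have t_le := glip t _ t0 tl (lexx _).
have := gdist_triangle (g s) p q; have := gdist_triangle (g t) (g s) q.
by rewrite mdist_gdist; move: s_le t_le; rewrite g0 gl; lra.
Qed.

End PathMetric.

Section PropertyB.
Variables (R : realType) (G : graph).
Local Notation X := (realization R G).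
Implicit Types (L : set (set X)) (a b : vert G).

Definition vertices : set X := range (@Vertex R G).

Definition geodesic_system L : Prop :=
  (forall S, L S -> exists x y, geodesic x y S) /\
  (forall a b, exists2 S, L S & geodesic (Vertex a) (Vertex b) S).

Definition paths L (x y : X) : set (set X) := [set S | L S /\ geodesic x y S].

Definition paths_between L (A B : set X) : set (set X) :=
  \bigcup_(x in A) \bigcup_(y in B) paths L x y.

Definition hull L (x y : X) : set X := \bigcup_(S in paths L x y) S.

Definition hull_between L (A B : set X) : set X :=
  \bigcup_(S in paths_between L A B) S.

Definition hull_balls L (a b : X) (r : R) : set X :=
  hull_between L (cball a r `&` vertices) (cball b r `&` vertices).

Definition property_B L (l k : R) (D : nat) : Prop :=
  [/\ 0 <= l, 0 <= k, (0 < D)%N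
    & forall (a b c : X) (r : nat),
        vertices a -> vertices b -> vertices c -> hull L a b c ->
        r%:R + l <= Num.min (mdist c a) (mdist c b) ->
        ((hull_balls L a b r%:R `&` cball c k `&` vertices) #<= `I_D)%card /\
        (forall x y S, cball a r%:R x -> cball b r%:R y -> geodesic x y S ->
           S `&` cball c k !=set0)].

End PropertyB.

(* Main.v *)
(* Fix a base vertex x0, cut the graph into annuli of large width W around x0,
   and cut the n-th annulus according to the vertex, at distance W n - K from
   x0, through which a geodesic of L leads from x0 to the point. If two points
   of the annulus are close to x, a thin triangle shows that the vertices
   chosen for them lie within 2 delta of a vertex c of a fixed geodesic of L
   from x0 to x, so property B at c leaves at most D of them. Since a small
   ball meets at most two annuli, it meets at most 2 D pieces. *)
Require Import Defs.
From HB Require Import structures.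
From mathcomp Require Import all_boot all_order all_algebra.
From mathcomp Require Import all_classical all_reals all_analysis.
From mathcomp Require Import lra zify.

Import Order.TTheory GRing.Theory Num.Theory.
Local Open Scope classical_set_scope.
Local Open Scope ring_scope.

(** * Counting by injections into initial segments of the naturals *)

Lemma card_le_IIP (T : Type) (A : set T) (n : nat) :
  (A #<= `I_n)%card <->
  exists f : T -> nat, (forall x, A x -> (f x < n)%N) /\
    (forall x y, A x -> A y -> f x = f y -> x = y).
Proof.
split=> [/pcard_leP[f]|[f [fn f_inj]]].
  exists f; split=> [x Ax|x y Ax Ay]; first by have := @funS _ _ _ _ f x Ax.
  by apply: inj; rewrite inE.
have /card_le_eql <- : (f @` A #= A)%card.
  by apply: inj_card_eq => x y /set_mem Ax /set_mem Ay; apply: f_inj.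
by apply: subset_card_le => _ [x Ax <-]; apply: fn.
Qed.

Lemma card_le_setU_II (T : Type) (A B : set T) (m n : nat) :
  (A #<= `I_m)%card -> (B #<= `I_n)%card -> (A `|` B #<= `I_(m + n))%card.
Proof.
move=> /card_le_IIP[f [fm f_inj]] /card_le_IIP[g [gn g_inj]].
apply/card_le_IIP; exists (fun x => if `[< A x >] then f x else (m + g x)%N).
split=> [x ABx|x y ABx ABy].
  case: asboolP => [/fm|nAx]; first by lia.
  by case: ABx => // /gn; lia.
case: asboolP => [Ax|nAx]; case: asboolP => [Ay|nAy].
- exact: f_inj.
- by have := fm _ Ax; lia.
- by have := fm _ Ay; lia.
- by case: ABx ABy => // Bx [] // By /addnI; apply: g_inj.
Qed.

(** * Geodesics and thin triangles in a metric space *)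

Section Geodesics.
Context {R : realType} {X : metricType R}.
Implicit Types (x y c : X) (S : set X) (d t : R).

Lemma geodesic_sym x y S : geodesic x y S -> geodesic y x S.
Proof.
move=> [g [g0 gl giso ->]]; exists (fun t => g (mdist x y - t)).
rewrite [mdist y x]metric_sym subr0 subrr; split=> // [s t sl tl|].
  rewrite giso; try lra.
  by rewrite [RHS]distrC; congr `|_|; lra.
apply/seteqP; split=> _ [t /= tl <-]; exists (mdist x y - t) => /=.
- lra.
- by congr g; lra.
- lra.
- by [].
Qed.

Lemma geodesic_dist x y S c :
  geodesic x y S -> S c -> mdist x c + mdist c y = mdist x y.
Proof.
move=> [g [g0 gl giso ->]] [t /= tl <-].
have l0 := mdist_ge0 x y.
rewrite -[in mdist x (g t)]g0 -[in mdist (g t) y]gl !giso; try lra.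
by rewrite sub0r normrN ger0_norm ?ler0_norm; lra.
Qed.

Lemma geodesic_dist_same x y S c c' : geodesic x y S -> S c -> S c' ->
  mdist c c' = `|mdist x c - mdist x c'|.
Proof.
move=> [g [g0 gl giso ->]] [s /= sl <-] [t /= tl <-].
have l0 := mdist_ge0 x y.
rewrite -[in mdist x (g s)]g0 -[in mdist x (g t)]g0 !giso; try lra.
by rewrite !sub0r !normrN (@ger0_norm _ s) ?(@ger0_norm _ t); lra.
Qed.

Lemma geodesic_at x y S t : geodesic x y S -> 0 <= t <= mdist x y ->
  exists2 c, S c & mdist x c = t.
Proof.
move=> [g [g0 gl giso ->]] tl; exists (g t); first by exists t.
have l0 := mdist_ge0 x y.
rewrite -[in LHS]g0 giso; try lra.
by rewrite sub0r normrN ger0_norm; lra.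
Qed.

(** Thinness puts [c'] within [d] of a point [z] of the side from [y'] to [y] or of [S]. The first
    is excluded, as that side stays within [mdist y y'] of [y']. For [z] on [S], the distances of
    [z] and [c] from [x] differ by at most [d], hence [z] is within [d] of [c] along [S]. *)
Lemma hyperbolic_fellow_travel d x y y' S S' c c' : hyperbolic X d ->
  geodesic x y S -> geodesic x y' S' -> S c -> S' c' ->
  mdist x c = mdist x c' -> mdist y y' + d < mdist y' c' ->
  mdist c c' <= 2 * d.
Proof.
move=> [_ geo thin] Sxy Sxy' Sc Sc' xc far.
have [T Ty'y] := geo y' y.
have [/(_ _ Sc')[z TSz c'z] _ _] :=
  thin _ _ _ _ _ _ Sxy' Ty'y (geodesic_sym _ _ _ Sxy).
case: TSz => [Tz|Sz].
  have := metric_triangle y' z c'; have := geodesic_dist _ _ _ _ Ty'y Tz.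
  have := mdist_ge0 z y; move: far.
  by rewrite (metric_sym z c') (metric_sym y y'); lra.
have := metric_triangle c z c'; have := metric_triangle x z c'.
have := metric_triangle x c' z; rewrite (metric_sym z c').
rewrite (geodesic_dist_same _ _ _ _ _ Sxy Sc Sz) => xz xc' cc'.
have : `|mdist x c - mdist x z| <= d by rewrite ler_norml; lra.
lra.
Qed.

End Geodesics.

(** * Vertices on geodesics of the realization *)

Section Realization.
Context {R : realType} {G : graph}.
Local Notation X := (realization R G).
Local Notation Vtx := (@Vertex R G).
Implicit Types (u v : vert G) (x y : X).

Lemma mdist_vertex u v : mdist (Vtx u) (Vtx v) = (vdist u v)%:R.
Proof.
have [[b [c E]]|[e [s [t [hs [ht []]]]]]] := gdist_cases (Vtx u) (Vtx v) => //.
by rewrite mdist_gdist E /route /= add0r addr0.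
Qed.

Lemma Vertex_inj : injective Vtx.
Proof. by move=> u v []. Qed.

(** The distance from a vertex to an interior point of an edge is [m + t] or [m + (1 - t)] with [m]
    natural and [0 < t < 1], so it is never an integer. *)
Lemma vertex_at_nat_dist u x (n : nat) :
  mdist (Vtx u) x = n%:R -> exists v, x = Vtx v.
Proof.
case: x => [v|e t ht]; first by exists v.
have [[b [c E]]|[e' [s [t' [hs [ht' []]]]]]] :=
  gdist_cases (Vtx u) (Inner e t ht) => //.
rewrite mdist_gdist {}E /route /= add0r.
move: (vdist _ _) => m mn; exfalso.
have : (m < n)%N by rewrite -(ltr_nat R); case: c mn => mn; lra.
have : (n < m.+1)%N by rewrite -(ltr_nat R) -natr1; case: c mn => mn; lra.
lia.
Qed.

Lemma geodesic_vertex_at u v S (n : nat) : geodesic (Vtx u) (Vtx v) S ->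
  (n <= vdist u v)%N -> exists2 c, S (Vtx c) & vdist u c = n.
Proof.
move=> gS n_le; have [|x Sx ux] := geodesic_at _ _ _ n%:R gS.
  by rewrite mdist_vertex ler0n ler_nat.
have [c xc] := vertex_at_nat_dist _ _ _ ux; exists c; first by rewrite -xc.
by apply/eqP; rewrite -(eqr_nat R) -mdist_vertex -xc ux.
Qed.

Lemma vdist_geodesic u v S c : geodesic (Vtx u) (Vtx v) S -> S (Vtx c) ->
  (vdist u c + vdist c v)%N = vdist u v.
Proof.
move=> gS Sc; apply/eqP; rewrite -(eqr_nat R) natrD -!mdist_vertex.
exact/eqP/(geodesic_dist _ _ _ _ gS Sc).
Qed.

Lemma mdist_exit x b : mdist x (Vtx (exit x b)) <= 1.
Proof.
rewrite mdist_gdist.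
apply: le_trans (gdist_le_route _ _ b true) _.
rewrite /route /= vdistxx addr0 addr0.
by case: x => [v|e t ht] /=; [lra|case: b; lra].
Qed.

(** Moving to an exit costs at most 1 at each end. This is why property B, which speaks of vertices,
    is applied below with radius [r.+2]. *)
Lemma vdist_exit_le x y b c (r : nat) : mdist x y <= r%:R ->
  (vdist (exit x b) (exit y c) <= r.+2)%N.
Proof.
move=> xy; rewrite -(ler_nat R) -mdist_vertex -!natr1.
have := metric_triangle (Vtx (exit x b)) x (Vtx (exit y c)).
have := metric_triangle x y (Vtx (exit y c)).
have := mdist_exit x b; have := mdist_exit y c.
by rewrite (metric_sym _ x); lra.
Qed.

(** * The pieces of the annuli *)

(** A point is located by one of its exits. It belongs to the piece of every eligible vertex [i.2],
    so no geodesic is chosen and pieces may overlap. *)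
Definition annulus_piece (L : set (set X)) (o : vert G) (W K : nat)
    (i : nat * vert G) : set X :=
  [set y | [/\ (vdist o (exit y true) %/ W)%N = i.1,
               vdist o i.2 = (W * i.1 - K)%N
             & hull L (Vtx o) (Vtx (exit y true)) (Vtx i.2)]].

Section Cover.
Context {L : set (set X)} {o : vert G} {W K : nat}.
Hypothesis W_gt0 : (0 < W)%N.
Hypothesis L_geo : geodesic_system L.

Lemma annulus_piece_cover : \bigcup_i annulus_piece L o W K i = [set: X].
Proof.
apply/seteqP; split=> // y _; have [_ /(_ o (exit y true))[S LS gS]] := L_geo.
set d := vdist o (exit y true).
have [|c Sc oc] := geodesic_vertex_at _ _ _ (W * (d %/ W) - K) gS.
  by have := leq_trunc_div d W; rewrite -/d mulnC; lia.
by exists ((d %/ W)%N, c) => //; split=> //; exists S.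
Qed.

(** The vertex [i.2] acts as a center: an exit in annulus [i.1] is less than [W + K] farther from
    [o] than [i.2], on a common geodesic from [o]. *)
Lemma annulus_piece_diameter i x y : annulus_piece L o W K i x ->
  annulus_piece L o W K i y -> mdist x y <= (2 * (W + K).+1)%:R.
Proof.
have near z : annulus_piece L o W K i z -> mdist z (Vtx i.2) <= (W + K).+1%:R.
  move=> [zi oi [S [_ gS] Si]].
  apply: le_trans (metric_triangle _ (Vtx (exit z true)) _) _.
  rewrite mdist_vertex -natr1 [leRHS]addrC lerD ?mdist_exit// ler_nat vdistC.
  have := vdist_geodesic _ _ _ _ gS Si.
  have := divn_eq (vdist o (exit z true)) W.
  by have := ltn_pmod (vdist o (exit z true)) W_gt0; rewrite zi; lia.
move=> /near xi /near yi.
apply: le_trans (metric_triangle _ (Vtx i.2) _) _.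
by rewrite (metric_sym _ y) mul2n -addnn natrD lerD.
Qed.

End Cover.

(** The bound on [K] serves at the outer end of the geodesics, for both property B and the thin
    triangle; the bound on [W] serves at the end [o]. *)
Lemma annulus_piece_fiber (L : set (set X)) (o : vert G) (W K r D : nat)
    (delta l : R) (x : X) (n : nat) :
  hyperbolic X delta -> geodesic_system L ->
  property_B L l (2 * delta) D ->
  r.+2%:R + r.+2%:R + l + delta < K%:R -> K%:R + r.+2%:R + l <= W%:R ->
  ([set i | i.1 = n /\ cball x r%:R `&` annulus_piece L o W K i !=set0]
     #<= `I_D)%card.
Proof.
move=> hyp L_geo [l0 d0 D_gt0 B] K_big W_big.
have delta0 : 0 <= delta by case: hyp.
have K_nat : (r.+2 < K)%N by rewrite -(ltr_nat R); have := ler0n R r.+2; lra.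
have W_nat : (K <= W)%N by rewrite -(ler_nat R); have := ler0n R r.+2; lra.
have W_gt0 : (0 < W)%N by lia.
set F := [set i | _].
(* Truncated subtraction leaves o as the only choice in the innermost annulus. *)
have [n0|n_gt0] := posnP n.
  apply/card_le_IIP; exists (fun=> 0%N); split=> // -[m c] [m' c'].
  move=> [/= -> [y [_ [_ /= oc _]]]] [/= -> [y' [_ [_ /= oc' _]]]] _.
  move: oc oc'; rewrite n0 muln0 sub0n.
  by move=> /vdist_eq0 <- /vdist_eq0 <-.
(* A piece met by the ball shows that [b] is not far below level [W * n], so that [c0] exists. *)
have [[i0 [i0n [y0 [xy0 [y0n _ _]]]]]|F0] := pselect (exists i, F i); last first.
  apply/card_le_IIP; exists (fun=> 0%N); split=> // i j Fi.
  by case: F0; exists i.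
set b := exit x true.
have far y : (vdist o (exit y true) %/ W)%N = n ->
    (W * n <= vdist o (exit y true))%N.
  by move=> <-; rewrite mulnC leq_trunc_div.
have Wn : (W <= W * n)%N by rewrite leq_pmulr.
have ob : (W * n <= vdist o b + r.+2)%N.
  rewrite i0n in y0n; apply: leq_trans (far _ y0n) _.
  apply: leq_trans (vdist_triangle _ b _) _.
  by rewrite leq_add2l; apply: vdist_exit_le.
have [_ /(_ o b)[S0 LS0 gS0]] := L_geo.
have [|c0 S0c0 oc0] := geodesic_vertex_at _ _ _ (W * n - K) gS0; first by lia.
have c0b := vdist_geodesic _ _ _ _ gS0 S0c0.
have [|||||+ _] := B (Vtx o) (Vtx b) (Vtx c0) r.+2.
- by exists o.
- by exists b.
- by exists c0.
- by exists S0.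
(* The vertex [c0] is at distance at least [W - K] from [o] and at least [K - r.+2] from [b]; both
   are at least [r.+2 + l]. *)
- rewrite le_min !mdist_vertex vdistC oc0 natrB; last by lia.
  have : (K%:R : R) <= (vdist c0 b)%:R + r.+2%:R by rewrite -natrD ler_nat; lia.
  have : (W%:R : R) <= (W * n)%:R by rewrite ler_nat.
  by move=> ? ?; apply/andP; split; lra.
pose C := [set Vtx i.2 | i in F].
have /card_le_eql <- : (C #= F)%card.
  apply: inj_card_eq => -[m c] [m' c'] /set_mem [/= -> _] /set_mem [/= -> _].
  by move=> /Vertex_inj ->.
apply: card_le_trans; apply: subset_card_le.
move=> _ [[m c] [/= -> [y [xy [/= yn oc [S [LS gS] Sc]]]]] <-].
have bu : (vdist b (exit y true) <= r.+2)%N by apply: vdist_exit_le.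
split; last by exists c.
split.
  exists S => //; exists (Vtx o).
    by split; [rewrite /cball /= mdistxx|exists o].
  exists (Vtx (exit y true)) => //; split; last by exists (exit y true).
  by rewrite /cball /= mdist_vertex ler_nat.
(* The far ends [b] and [exit y true] are within [r.+2], while [c] is at least [K] from the
   latter. *)
apply: (hyperbolic_fellow_travel _ _ _ _ _ _ _ _ hyp gS0 gS S0c0 Sc).
  by rewrite !mdist_vertex oc oc0.
have uc := vdist_geodesic _ _ _ _ gS Sc.
rewrite !mdist_vertex (vdistC (exit y true)).
have : ((vdist b (exit y true))%:R : R) <= r.+2%:R by rewrite ler_nat.
have : (K%:R : R) <= (vdist c (exit y true))%:R.
  by rewrite ler_nat; have := far _ yn; lia.
by have := ler0n R r.+2; lra.
Qed.

End Realization.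

(** * Counting the pieces met by a ball *)

Theorem theorem1 (R : realType) (G : graph) (delta l : R) (D : nat)
    (L : set (set (realization R G))) :
  hyperbolic (realization R G) delta ->
  geodesic_system L ->
  property_B L l (2 * delta) D ->
  asdim_le (realization R G) (2 * D - 1)%N.
Proof.
move=> hyp L_geo B r.
(* Without a base vertex the realization is empty, since every point has an exit. *)
have [[v0]|G0] := pselect (inhabited (vert G)); last first.
  have X0 (x : realization R G) : False by apply: G0; exists; exact: exit x true.
  exists unit, (fun=> setT); split.
  - by apply/seteqP; split=> // x; case: (X0 x).
  - by exists 0 => i x; case: (X0 x).
  - by move=> x; case: (X0 x).
have [l0 d0 D_gt0 _] := B.
have [k k_big] : exists k : nat, l + delta < k%:R.
  by exists (Num.trunc (l + delta)).+1; apply: truncnS_gt.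
have delta0 : 0 <= delta by case: hyp.
pose K := (r.+2 + r.+2 + k)%N; pose W := (K + r.+2 + k)%N.
have W_gt0 : (0 < W)%N by rewrite /W /K; lia.
exists (nat * vert G)%type, (annulus_piece L v0 W K); split.
- exact: annulus_piece_cover.
- by exists (2 * (W + K).+1)%:R; apply: annulus_piece_diameter.
(* The lowest annulus that the ball can reach. *)
move=> x; set q := ((vdist v0 (exit x true) - r.+2) %/ W)%N.
(* The truncated subtraction is exact because [D] is positive. *)
have -> : (2 * D - 1).+1 = (D + D)%N by lia.
pose F n := [set i | i.1 = n /\ cball x r%:R `&` annulus_piece L v0 W K i !=set0].
have FD n : (F n #<= `I_D)%card.
  by apply: annulus_piece_fiber hyp L_geo B _ _; rewrite /W /K !natrD; lra.
apply: card_le_trans (card_le_setU_II _ _ _ _ _ (FD q) (FD q.+1)).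
apply: subset_card_le => i /= xi.
suff [iq|iq] : i.1 = q \/ i.1 = q.+1 by [left|right].
case: xi => y [xy [<- _ _]].
have xy' := vdist_exit_le _ _ true true _ xy.
set d := vdist v0 (exit y true); set e := vdist v0 (exit x true) in q *.
have de : (d <= e + r.+2)%N.
  by apply: leq_trans (vdist_triangle _ (exit x true) _) _; rewrite leq_add2l.
have ed : (e - r.+2 <= d)%N.
  rewrite leq_subLR addnC; apply: leq_trans (vdist_triangle _ (exit y true) _) _.
  by rewrite leq_add2l vdistC.
have : (q <= d %/ W)%N by apply: leq_div2r.
(* Levels in the ball spread over at most [2 * r.+2], which is at most [W]; thus
   [d <= (e - r.+2) + W], even if the subtraction truncates. *)
have : (d %/ W <= q.+1)%N.
  apply: (@leq_trans (((e - r.+2) + W) %/ W)%N).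
    by apply: leq_div2r; rewrite /W /K; lia.
  by rewrite divnDr ?dvdnn// divnn W_gt0 addn1.
lia.
Qed.
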